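(* Let $f:\mathbb R^n\to(-\infty,+\infty]$ and $g:\mathbb R^m\to(-\infty,+\infty]$ be proper lower semicontinuous convex functions, let $A\in\mathbb R^{m\times n}$, and let $z_*$ be an optimal solution of the minimax problem $\min_{x\in\mathbb R^n}\max_{y\in\mathbb R^m} f(x)+\langle Ax,y\rangle-g(y)$. Let $0<s<\frac1{\|A\|}$ and let $z_k=(x_k,y_k)$, $k\ge 0$, be the iterates of PDHG with step-size $s$ started at an arbitrary point $z_0\in\mathbb R^n\times\mathbb R^m$. Then for every $k\ge 1$, $$\mathrm{dist}_{P_s^{-1}}^2\bigl(0,\mathcal F(z_{k})\bigr)\le \frac1k\,\|z_0-z_*\|_{P_s}^2 .$$
   Context: $\|A\|$ is the operator (spectral) norm, with $1/\|A\|=+\infty$ if $A=0$. For $\tau>0$ and convex $h$, $\mathrm{prox}_h^{\tau}(x)=\mathrm{argmin}_{u}\{h(u)+\frac1{2\tau}\|u-x\|_2^2\}$. PDHG (primal-dual hybrid gradient) with step-size $s>0$ is the iteration $$x_{k+1}=\mathrm{prox}_f^{s}(x_k-sA^Ty_k),\qquad y_{k+1}=\mathrm{prox}_g^{s}(y_k+sA(2x_{k+1}-x_k)).$$ For $z=(x,y)$, $\mathcal F(z)=\begin{pmatrix}\partial f(x)+A^Ty\\ -Ax+\partial g(y)\end{pmatrix}\subseteq\mathbb R^{n+m}$, where $\partial$ is the convex subdifferential. An optimal solution of the minimax problem is a point $z$ with $0\in\mathcal F(z)$ (equivalently, a saddle point). $P_s=\begin{pmatrix}\frac1sI_n&-A^T\\-A&\frac1sI_m\end{pmatrix}$,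 which is positive definite for $0<s<1/\|A\|$. For positive definite $M$, $\|u\|_M=\sqrt{u^TMu}$ and $\mathrm{dist}_M(z,\mathcal S)=\inf_{u\in\mathcal S}\|u-z\|_M$ (equal to $+\infty$ if $\mathcal S=\emptyset$). *)

(* Defs.v *)
From HB Require Import structures.
From mathcomp Require Import all_boot all_order all_algebra.
From mathcomp Require Import all_classical all_reals all_analysis.

Set Implicit Arguments.
Unset Strict Implicit.
Unset Printing Implicit Defensive.

Import Order.TTheory GRing.Theory Num.Theory.
Import numFieldNormedType.Exports.

Local Open Scope classical_set_scope.
Local Open Scope ring_scope.

Section Euclidean.
Context {R : realType}.

Definition dot {n} (u v : 'cV[R]_n) : R := (u^T *m v) 0 0.

(* The library norm on matrices is the sup norm, hence this one. *)
Definition norm2 {n} (u : 'cV[R]_n) : R := Num.sqrt (dot u u).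

Definition opnorm {m n} (A : 'M[R]_(m, n)) : R :=
  sup [set norm2 (A *m x) | x in [set x : 'cV[R]_n | norm2 x <= 1]].

(* Meaningful for M positive definite; [Num.sqrt] is 0 on negative reals. *)
Definition normM {n} (M : 'M[R]_n) (u : 'cV[R]_n) : R :=
  Num.sqrt ((u^T *m M *m u) 0 0).

Definition distM {n} (M : 'M[R]_n) (z : 'cV[R]_n) (S : set 'cV[R]_n) : \bar R :=
  ereal_inf [set (normM M (u - z))%:E | u in S].

End Euclidean.

Section ConvexAnalysis.
Context {R : realType} {n : nat}.
Implicit Types (h : 'cV[R]_n -> \bar R) (x u : 'cV[R]_n) (tau : R).

Definition proper_ereal h : Prop :=
  (forall x, (-oo < h x)%E) /\ (exists x, (h x < +oo)%E).

(* Only used for functions that never take the value -oo, so that the right-hand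
   side is never of the form +oo - oo. *)
Definition convex_ereal h : Prop :=
  forall (x y : 'cV[R]_n) (t : R), 0 < t -> t < 1 ->
    (h (t *: x + (1 - t) *: y)%R <= t%:E * h x + (1 - t)%:E * h y)%E.

(* For h proper, this is empty at the points x where h x = +oo. *)
Definition subdiff h x : set 'cV[R]_n :=
  [set v | forall u, (h x + (dot v (u - x))%:E <= h u)%E].

Definition prox_set h tau x : set 'cV[R]_n :=
  [set u | forall v,
    (h u + ((2 * tau)^-1 * norm2 (u - x) ^+ 2)%:E
     <= h v + ((2 * tau)^-1 * norm2 (v - x) ^+ 2)%:E)%E].

(* For tau > 0 and h proper, lower semicontinuous and convex, [prox_set h tau x]
   is a singleton and this is its element; the default 0 is returned only when
   there is no minimizer. *)
Definition prox h tau x : 'cV[R]_n := xget 0 (prox_set h tau x).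

End ConvexAnalysis.

(* A pair (x, y) is encoded as the stacked vector [col_mx x y]. *)
Section PDHG.
Context {R : realType} {n m : nat}.
Variables (f : 'cV[R]_n -> \bar R) (g : 'cV[R]_m -> \bar R) (A : 'M[R]_(m, n)).

Definition KKT (z : 'cV[R]_(n + m)) : set 'cV[R]_(n + m) :=
  let x := usubmx z in let y := dsubmx z in
  [set w | exists2 u, subdiff f x u & exists2 v, subdiff g y v &
           w = col_mx (u + A^T *m y) (- (A *m x) + v)].

Definition optimal (z : 'cV[R]_(n + m)) : Prop := KKT z 0.

Definition Pmat (s : R) : 'M[R]_(n + m) :=
  block_mx (s^-1)%:M (- A^T) (- A) (s^-1)%:M.

Definition pdhg_step (s : R) (z : 'cV[R]_(n + m)) : 'cV[R]_(n + m) :=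
  let x := usubmx z in let y := dsubmx z in
  let x' := prox f s (x - s *: (A^T *m y)) in
  let y' := prox g s (y + s *: (A *m (2 *: x' - x))) in
  col_mx x' y'.

Definition pdhg (s : R) (z0 : 'cV[R]_(n + m)) (k : nat) : 'cV[R]_(n + m) :=
  iter k (pdhg_step s) z0.

End PDHG.

(* Main.v *)
(** Each PDHG step is a proximal point step in the metric P = P_s: the optimality
    conditions of the two proximal subproblems say exactly that
    P (z_k - z_(k+1)) belongs to F(z_(k+1)). Since the P^-1-norm of this element
    is the P-norm of d_k = z_k - z_(k+1), it suffices to bound the latter.
    Monotonicity of F at z_(k+1) and z_* gives
    ||z_(k+1) - z_*||^2 + ||d_k||^2 <= ||z_k - z_*||^2, and monotonicity at two
    consecutive iterates shows that ||d_k|| is nonincreasing; summing yields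
    k ||d_(k-1)||^2 <= ||z_0 - z_*||^2. Proximal points exist because the
    subgradients at z_* bound the subproblems from below. *)
Require Import Defs.
From HB Require Import structures.
From mathcomp Require Import all_boot all_order all_algebra.
From mathcomp Require Import all_classical all_reals all_analysis.
From mathcomp Require Import ring lra.
Import Order.TTheory GRing.Theory Num.Theory.
Import numFieldNormedType.Exports.
Local Open Scope ring_scope.

Set Implicit Arguments.
Unset Strict Implicit.

(** * Euclidean inner product, Cauchy-Schwarz and the operator norm *)

Lemma dotE (R : realType) n (u v : 'cV[R]_n) :
  dot u v = \sum_i u i 0 * v i 0.
Proof. by rewrite /dot mxE; apply: eq_bigr => i _; rewrite mxE. Qed.

Lemma dotC (R : realType) n (u v : 'cV[R]_n) : dot u v = dot v u.
Proof. by rewrite !dotE; apply: eq_bigr => i _; rewrite mulrC. Qed.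

Lemma dotDl (R : realType) n (u v w : 'cV[R]_n) :
  dot (u + v) w = dot u w + dot v w.
Proof. by rewrite /dot linearD mulmxDl mxE. Qed.

Lemma dotZl (R : realType) n a (u w : 'cV[R]_n) :
  dot (a *: u) w = a * dot u w.
Proof. by rewrite /dot linearZ -scalemxAl mxE. Qed.

Lemma dotNl (R : realType) n (u w : 'cV[R]_n) : dot (- u) w = - dot u w.
Proof. by rewrite -scaleN1r dotZl mulN1r. Qed.

Lemma dotDr (R : realType) n (u v w : 'cV[R]_n) :
  dot w (u + v) = dot w u + dot w v.
Proof. by rewrite dotC dotDl !(dotC w). Qed.

Lemma dotZr (R : realType) n a (u w : 'cV[R]_n) :
  dot w (a *: u) = a * dot w u.
Proof. by rewrite dotC dotZl dotC. Qed.

Lemma dotNr (R : realType) n (u w : 'cV[R]_n) : dot w (- u) = - dot w u.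
Proof. by rewrite dotC dotNl dotC. Qed.

Definition dot_lin := (dotDl, dotZl, dotNl, dotDr, dotZr, dotNr).

Lemma dot_mull (R : realType) m n (A : 'M[R]_(m, n)) u v :
  dot (A *m u) v = dot u (A^T *m v).
Proof. by rewrite /dot trmx_mul mulmxA. Qed.

Lemma dot_ge0 (R : realType) n (u : 'cV[R]_n) : 0 <= dot u u.
Proof. by rewrite dotE sumr_ge0// => i _; rewrite -expr2 sqr_ge0. Qed.

Lemma dot_eq0 (R : realType) n (u : 'cV[R]_n) : dot u u = 0 -> u = 0.
Proof.
rewrite dotE => /eqP; rewrite psumr_eq0 => [/allP u0|i _]; last first.
  by rewrite -expr2 sqr_ge0.
apply/matrixP => i j; rewrite ord1 mxE.
by have /(_ (mem_index_enum i)) := u0 i; rewrite mulf_eq0 orbb => /eqP.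
Qed.

Lemma sqr_coord_le_dot (R : realType) n (u : 'cV[R]_n) i :
  u i 0 ^+ 2 <= dot u u.
Proof.
rewrite dotE (bigD1 i)//= expr2 lerDl sumr_ge0// => j _.
by rewrite -expr2 sqr_ge0.
Qed.

Lemma dot_col (R : realType) n m (x x' : 'cV[R]_n) (y y' : 'cV[R]_m) :
  dot (col_mx x y) (col_mx x' y') = dot x x' + dot y y'.
Proof. by rewrite /dot tr_col_mx mul_row_col mxE. Qed.

Lemma norm2_ge0 (R : realType) n (u : 'cV[R]_n) : 0 <= norm2 u.
Proof. exact: sqrtr_ge0. Qed.

Lemma sqr_norm2 (R : realType) n (u : 'cV[R]_n) : norm2 u ^+ 2 = dot u u.
Proof. by rewrite sqr_sqrtr// dot_ge0. Qed.

Lemma norm2_gt0 (R : realType) n (u : 'cV[R]_n) : u != 0 -> 0 < norm2 u.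
Proof.
move=> u0; rewrite lt0r norm2_ge0 andbT; apply: contra_neq u0 => u0.
by apply: dot_eq0; rewrite -sqr_norm2 u0 expr0n.
Qed.

Lemma norm2Z (R : realType) n a (u : 'cV[R]_n) :
  norm2 (a *: u) = `|a| * norm2 u.
Proof.
by rewrite /norm2 !dot_lin mulrA -expr2 sqrtrM ?sqr_ge0// sqrtr_sqr.
Qed.

Lemma norm2_0 (R : realType) n : norm2 (0 : 'cV[R]_n) = 0.
Proof. by rewrite -(scale0r 0) norm2Z normr0 mul0r. Qed.

Lemma dot_le_norm2 (R : realType) n (u v : 'cV[R]_n) :
  dot u v <= norm2 u * norm2 v.
Proof.
have [->|u0] := eqVneq u 0.
  by rewrite norm2_0 -(scale0r 0) dotZl !mul0r.
have [->|v0] := eqVneq v 0.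
  by rewrite norm2_0 -(scale0r 0) dotZr mul0r mulr0.
(* Expands to [2 * |u| * |v| * (|u| * |v| - dot u v) >= 0]; the positive factor cancels. *)
have := dot_ge0 (norm2 v *: u - norm2 u *: v).
rewrite !dot_lin -!sqr_norm2 (dotC v u).
have uv0 : 0 < norm2 u * norm2 v by rewrite mulr_gt0// norm2_gt0.
by move=> h; rewrite -(ler_pM2l uv0); nra.
Qed.

(** Makes the real [sup] in [opnorm] a genuine least upper bound. The bound is the Frobenius norm,
    by Cauchy-Schwarz on each row. *)
Lemma opnorm_bounded (R : realType) m n (A : 'M[R]_(m, n)) :
  has_ubound [set norm2 (A *m x) | x in [set x : 'cV[R]_n | norm2 x <= 1]]%classic.
Proof.
exists (Num.sqrt (\sum_i norm2 (row i A)^T ^+ 2)) => _ [x /= x1 <-].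
rewrite ler_wsqrtr// dotE ler_sum// => i _; rewrite -expr2.
have -> : (A *m x) i 0 = dot (row i A)^T x.
  by rewrite dotE mxE; apply: eq_bigr => j _; rewrite !mxE.
rewrite -real_normK ?num_real// ler_sqr ?nnegrE ?norm2_ge0//.
rewrite ler_norml; have b0 := norm2_ge0 (row i A)^T.
have le1 : norm2 (row i A)^T * norm2 x <= norm2 (row i A)^T by rewrite ler_piMr.
rewrite lerNl -dotNr !(le_trans (dot_le_norm2 _ _))//.
by rewrite -scaleN1r norm2Z normrN1 mul1r.
Qed.

Lemma opnorm_ge0 (R : realType) m n (A : 'M[R]_(m, n)) : 0 <= opnorm A.
Proof.
apply: le_trans (ub_le_sup (opnorm_bounded A) _).
  exact: (norm2_ge0 (A *m 0)).
by exists 0 => //=; rewrite norm2_0.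
Qed.

Lemma norm2_mul_le (R : realType) m n (A : 'M[R]_(m, n)) x :
  norm2 (A *m x) <= opnorm A * norm2 x.
Proof.
have [->|x0] := eqVneq x 0.
  by rewrite mulmx0 !norm2_0 mulr0.
have Nx := norm2_gt0 x0.
rewrite -ler_pdivrMr// mulrC.
apply: ub_le_sup; first exact: opnorm_bounded.
exists ((norm2 x)^-1 *: x) => /=.
  by rewrite norm2Z gtr0_norm ?invr_gt0// mulVf ?gt_eqF.
by rewrite -scalemxAr norm2Z gtr0_norm ?invr_gt0.
Qed.

(** * Existence of proximal points *)

Lemma continuous_dot_diag (R : realType) n (x : 'cV[R]_n) :
  continuous (fun v : 'cV[R]_n => dot (v - x) (v - x)).
Proof.
rewrite (_ : (fun v => _) =
    \sum_(i < n) (fun v : 'cV[R]_n => (v i 0 - x i 0) * (v i 0 - x i 0))).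
  apply: (big_ind (fun F : 'cV[R]_n -> R => continuous F)) => [|F G cF cG|i _] v.
  - exact: (@cst_continuous _ _ (0 : R)).
  - exact: (continuousD (cF v) (cG v)).
  - have cB : {for v, continuous (fun w : 'cV[R]_n => w i 0 - x i 0)}.
      apply: continuousB; first exact: coord_continuous.
      exact: (@cst_continuous _ _ (x i 0)).
    exact: (continuousM cB cB).
apply/funext => v; rewrite dotE fct_sumE.
by apply: eq_bigr => i _; rewrite !mxE.
Qed.

Lemma convex_ereal_midpoint (R : realType) n (h : 'cV[R]_n -> \bar R) u v a b :
  convex_ereal h -> (h u <= a%:E)%E -> (h v <= b%:E)%E ->
  (h (2^-1 *: (u + v)) <= (2^-1 * (a + b))%:E)%E.
Proof.
move=> hc ua vb.
have h2 : 1 - 2^-1 = 2^-1 :> R by lra.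
have := hc u v 2^-1; rewrite h2 -scalerDr invr_gt0 ltr0n.
move=> /(_ isT (ltac:(lra))) /le_trans; apply.
by rewrite mulrDr EFinD !EFinM leeD// lee_pmul2l// lte_fin invr_gt0.
Qed.

(* Strong convexity makes the sublevel sets of the objective shrink as the level
   decreases to the infimum, so they generate a Cauchy filter; by lower
   semicontinuity its limit is a minimizer. The affine minorant given by [v0]
   makes the infimum finite. *)
Lemma prox_set_nonempty (R : realType) n (h : 'cV[R]_n -> \bar R) (tau : R)
    (x x0 v0 : 'cV[R]_n) :
  0 < tau -> proper_ereal h -> lower_semicontinuous h -> convex_ereal h ->
  subdiff h x0 v0 -> (prox_set h tau x !=set0)%classic.
Proof.
move=> tau0 [hNy [y0 hy0]] hlsc hconv sub0.
set c := (2 * tau)^-1; have c0 : 0 < c by rewrite invr_gt0 mulr_gt0.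
pose q (v : 'cV[R]_n) : R := c * dot (v - x) (v - x).
have hfin v r : (h v <= r%:E)%E -> exists b, h v = b%:E.
  by have := hNy v; case: (h v) => // b _ _; exists b.
have [b0 hx0] : exists b, h x0 = b%:E.
  have /= := sub0 y0; have := hNy x0; case: (h x0) => // [b|_]; first by exists b.
  by rewrite addye// leye_eq => /eqP hy; rewrite hy in hy0.
(* [E] holds the real upper bounds of values of [h + q]; moving [q] to the right keeps the sum on
   the real side. *)
pose E := [set r | exists v, (h v <= (r - q v)%:E)%E]%classic.
have EN0 : (E !=set0)%classic.
  by exists (b0 + q x0), x0; rewrite addrK hx0.
have Elb : has_lbound E.
  (* With [w = v - x], the minimum of [dot v0 w + dot w w / (2 * tau)] is [- tau / 2 * dot v0 v0],
     attained at [w = - tau *: v0]. *)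
  exists (b0 + dot v0 (x - x0) - tau / 2 * dot v0 v0) => r [v hv].
  have := le_trans (sub0 v) hv; rewrite hx0 -EFinD lee_fin /q.
  have -> : v - x0 = (v - x) + (x - x0) by rewrite addrA subrK.
  move: (v - x) (x - x0) => w z.
  have := dot_ge0 (w + tau *: v0).
  rewrite !dot_lin (dotC w v0) => sq le1.
  have : 0 <= c * (dot w w + tau * dot v0 w + tau * (dot v0 w + tau * dot v0 v0)).
    by rewrite mulr_ge0// ltW.
  rewrite !mulrDr.
  have ct : c * tau = 2^-1 by rewrite /c; field; rewrite gt_eqF.
  rewrite !mulrA ct. lra.
pose i := inf E.
have iE r : E r -> i <= r by exact: ge_inf.
pose Q e := [set v | h v <= (i + e - q v)%:E]%E%classic.
have QN0 e : 0 < e -> (Q e !=set0)%classic.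
  move=> e0; have [r [v hv] re] := inf_adherent e0 (conj EN0 Elb).
  exists v; apply: le_trans hv _; rewrite lee_fin lerB// ltW//.
have QS e e' : e <= e' -> (Q e `<=` Q e')%classic.
  move=> ee' v /= /le_trans; apply; rewrite lee_fin; lra.
pose F := filter_from [set e | 0 < e]%classic Q.
have FF : ProperFilter F.
  apply: filter_from_proper => //.
  apply: filter_from_filter; first by exists 1 => /=.
  move=> e e' /= e0 e'0; exists (Num.min e e'); first by rewrite lt_min e0.
  by move=> v Qv; split; apply: QS Qv; rewrite ge_min lexx ?orbT.
(* The objective at the midpoint [w] is at least [i], while convexity and the parallelogram identity
   put it below [i + e] by a quarter of [c * dot (v - u) (v - u)]. *)
have Qdiam e u v : Q e u -> Q e v -> c * dot (v - u) (v - u) <= 4 * e.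
  move=> Qu Qv; have := convex_ereal_midpoint hconv Qu Qv.
  set w := 2^-1 *: (u + v); set r := (_ * _) => hw.
  have Er : E (r + q w) by exists w; rewrite addrK.
  have := iE _ Er.
  have -> : q w = 2^-1 * (q u + q v) - 4^-1 * (c * dot (v - u) (v - u)).
    rewrite /q /w !dot_lin (dotC u x) (dotC v x) (dotC v u); lra.
  rewrite /r; lra.
have Fcauchy : cauchy F.
  apply: cauchy_exP => eps eps0.
  (* By [Qdiam], [c] times the squared distance is at most [4 * d], half of [c * eps ^+ 2]; this
     controls every coordinate, hence the sup-norm ball. *)
  pose d := c * eps ^+ 2 / 8.
  have d0 : 0 < d by rewrite divr_gt0// mulr_gt0// exprn_gt0.
  have [u Qu] := QN0 _ d0; exists u; exists d => //= v Qv.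
  split=> // j k; rewrite ord1 -ball_normE /=.
  suff : `|u j 0 - v j 0| ^+ 2 < eps ^+ 2 by rewrite ltr_sqr// nnegrE ltW.
  rewrite real_normK ?num_real//.
  have := Qdiam _ _ _ Qv Qu; have := sqr_coord_le_dot (u - v) j; rewrite !mxE.
  move=> /le_lt_trans le1 le2; apply: le1.
  rewrite -(ltr_pM2l c0); apply: le_lt_trans le2 _.
  have : 0 < c * eps ^+ 2 by rewrite mulr_gt0 ?exprn_gt0.
  rewrite /d; lra.
have /cauchy_cvgP/cvg_ex[p Fp] := Fcauchy.
(* Otherwise [h > i - q p + 2 * d] and [q > q p - d] near [p], so [h + q > i + d] there, yet [Q d]
   meets every neighbourhood of [p]. *)
have hp : (h p <= (i - q p)%:E)%E.
  rewrite leNgt; apply/negP => ip.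
  have [d d0 hd] : exists2 d, 0 < d & ((i - q p + 2 * d)%:E < h p)%E.
    move: ip; case: (h p) => [r| |//].
      rewrite lte_fin => ir; exists ((r - (i - q p)) / 4); first lra.
      rewrite lte_fin; lra.
    by exists 1 => //; rewrite ltry.
  have [V Vp hV] := hlsc _ _ hd.
  have qp : \forall v \near p, q p - d < q v.
    have qc : continuous q.
      move=> v; apply: (@continuousM _ _ (fun=> c)
        (fun v : 'cV[R]_n => dot (v - x) (v - x))).
        exact: (@cst_continuous _ _ c).
      exact: continuous_dot_diag.
    have qd : q p - d < q p by rewrite ltrBlDr ltrDl.
    exact: (cvgr_gt _ (qc p) _ qd).
  have FQ : F (Q d) by exists d.
  have [v [[/hV hv qv] Qv]] := filter_ex (filterI (filterI (Fp _ Vp) (Fp _ qp)) FQ).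
  have := lt_le_trans hv Qv; rewrite lte_fin.
  by move: qv; lra.
exists p => v; rewrite !sqr_norm2 -/c -/(q p) -/(q v).
have : (h p + (q p)%:E <= i%:E)%E.
  by have [b hb] := hfin _ _ hp; move: hp; rewrite hb -EFinD !lee_fin; lra.
move=> /le_trans; apply.
have := hNy v; case hv : (h v) => [r| |//] _; last by rewrite addye// leey.
by rewrite -EFinD lee_fin; apply: iE; exists v; rewrite addrK hv.
Qed.

(** * Subgradients: optimality condition of the proximal map, monotonicity *)

Lemma prox_subdiff (R : realType) n (h : 'cV[R]_n -> \bar R) (tau : R)
    (x u : 'cV[R]_n) :
  0 < tau -> proper_ereal h -> convex_ereal h ->
  prox_set h tau x u -> subdiff h u (tau^-1 *: (x - u)).
Proof.
move=> tau0 [hNy [y0 hy0]] hconv hu v /=.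
have [b hb] : exists b, h u = b%:E.
  have := hu y0; have := hNy u; case: (h u) => // [b|_]; first by exists b.
  rewrite addye// leye_eq => /eqP hy.
  by have := lte_add_pinfty hy0 (ltry ((2 * tau)^-1 * norm2 (y0 - x) ^+ 2)); rewrite hy.
have := hNy v; case hv : (h v) => [a| |//] _; last by rewrite leey.
rewrite hb -EFinD lee_fin.
have c0 : 0 < (2 * tau)^-1 by rewrite invr_gt0 mulr_gt0.
have -> : tau^-1 = 2 * (2 * tau)^-1 by field; rewrite gt_eqF.
move: hu c0; rewrite /prox_set /=; move: (2 * tau)^-1 => c hu c0.
have K0 : 0 <= c * dot (v - u) (v - u) by rewrite mulr_ge0 ?dot_ge0// ltW.
(* Minimality of [u] is tested at [t *: v + (1 - t) *: u]; convexity and division by [t] leave an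
   error linear in [t]. The choice [t = e / (e + K + 1)] is below 1 and makes that error at most
   [e]. *)
suff key t : 0 < t -> t < 1 ->
    b + dot ((2 * c) *: (x - u)) (v - u) <= a + t * (c * dot (v - u) (v - u)).
  move: K0 key; set K := c * _; move=> K0 key; apply/ler_addgt0Pr => e e0.
  have eK : 0 < e + K + 1 by lra.
  apply: le_trans (key (e / (e + K + 1)) _ _) _.
  - by rewrite divr_gt0.
  - by rewrite ltr_pdivrMr// mul1r; lra.
  - by rewrite lerD2l mulrAC ler_pdivrMr// ler_pM2l//; lra.
move=> t0 t1.
have := le_trans (hu (t *: v + (1 - t) *: u)) (leeD2r _ (hconv v u t t0 t1)).
rewrite hb hv !sqr_norm2 -!EFinM -!EFinD lee_fin.
have -> : t *: v + (1 - t) *: u - x = t *: (v - u) + (u - x).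
  by apply/matrixP => j k; rewrite !mxE; ring.
have -> : x - u = - (u - x) by rewrite opprB.
move: (v - u) (u - x) => w z.
by rewrite !dot_lin (dotC w z) => ineq; rewrite -(ler_pM2l t0); lra.
Qed.

(** Each subgradient inequality is tested at the other point; in the sum the values of [h] cancel,
    being finite by properness. *)
Lemma subdiff_monotone (R : realType) n (h : 'cV[R]_n -> \bar R) x x' v v' :
  proper_ereal h -> subdiff h x v -> subdiff h x' v' ->
  0 <= dot (v - v') (x - x').
Proof.
move=> [hNy [y0 hy0]].
have hfin w r : subdiff h w r -> exists b, h w = b%:E.
  move=> /(_ y0); have := hNy w; case: (h w) => // [b|_]; first by exists b.
  by rewrite addye// leye_eq => /eqP hy; rewrite hy in hy0.
move=> hv hv'; have [b hb] := hfin _ _ hv; have [b' hb'] := hfin _ _ hv'.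
have := hv x'; have := hv' x; rewrite hb hb' -!EFinD !lee_fin -(opprB x x').
rewrite dotDl !dotNl dotNr; lra.
Qed.

(** * Positive definiteness of the metric [Pmat A s] *)

Section primal_dual_metric.
Context {R : realType} {n m : nat}.
Variables (A : 'M[R]_(m, n)) (s : R).

Lemma tr_Pmat : (Pmat A s)^T = Pmat A s.
Proof. by rewrite /Pmat tr_block_mx !tr_scalar_mx !linearN /= trmxK. Qed.

Lemma mul_Pmat_col (x : 'cV[R]_n) (y : 'cV[R]_m) : Pmat A s *m col_mx x y =
  col_mx (s^-1 *: x - A^T *m y) (s^-1 *: y - A *m x).
Proof. by rewrite mul_block_col !mul_scalar_mx !mulNmx [- _ + _]addrC. Qed.

Hypotheses (s_gt0 : 0 < s) (s_lt : (s%:E < ((opnorm A)%:E)^-1)%E).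

Lemma step_opnorm_lt1 : s * opnorm A < 1.
Proof.
(* If [opnorm A = 0], its extended inverse is [+oo] and the goal is [0 < 1]. *)
move: s_lt; rewrite inver; case: eqP => [-> _|/eqP A0]; first by rewrite mulr0.
rewrite lte_fin -ltr_pdivlMr ?div1r//.
by rewrite lt0r A0 opnorm_ge0.
Qed.

(** With [p = |x|], [q = |y|], [L = opnorm A], the form times [s] is at least [p^2 + q^2 - 2 s L p q
    = (1 - s L) (p^2 + q^2) + s L (p - q)^2]. *)
Lemma Pmat_gt0 (z : 'cV[R]_(n + m)) : z != 0 -> 0 < dot z (Pmat A s *m z).
Proof.
move=> z0.
have zz : 0 < dot z z by rewrite lt0r dot_ge0 andbT; apply: contra_neq z0; exact: dot_eq0.
move: zz; rewrite -(vsubmxK z) mul_Pmat_col !dot_col.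
move: (usubmx z) (dsubmx z) => x y; rewrite !dot_lin -dot_mull (dotC y).
have := le_trans (dot_le_norm2 (A *m x) y)
  (ler_wpM2r (norm2_ge0 y) (norm2_mul_le A x)).
have := step_opnorm_lt1; have := opnorm_ge0 A; rewrite -!sqr_norm2.
move: (opnorm A) (norm2 x) (norm2 y) (norm2_ge0 x) (norm2_ge0 y) => L p q p0 q0.
move: (dot _ _) => d L0 sL dle pq; rewrite -(pmulr_rgt0 _ s_gt0).
have -> : s * (s^-1 * p ^+ 2 - d + (s^-1 * q ^+ 2 - d)) = p ^+ 2 + q ^+ 2 - 2 * (s * d).
  by field; rewrite gt_eqF.
have sd : s * d <= s * L * (p * q).
  by rewrite -!mulrA ler_pM2l// mulrA.
have := mulr_ge0 (mulr_ge0 (ltW s_gt0) L0) (sqr_ge0 (p - q)).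
have : 0 < (1 - s * L) * (p ^+ 2 + q ^+ 2) by rewrite mulr_gt0// subr_gt0.
lra.
Qed.

Lemma Pmat_ge0 (z : 'cV[R]_(n + m)) : 0 <= dot z (Pmat A s *m z).
Proof.
have [->|/Pmat_gt0/ltW//] := eqVneq z 0.
by rewrite mulmx0 dot_ge0.
Qed.

Lemma Pmat_unit : Pmat A s \in unitmx.
Proof.
rewrite -row_free_unit -kermx_eq0; apply/rowV0P => v /sub_kermxP vP0.
apply/eqP; apply: contra_eqT vP0 => v0.
have /Pmat_gt0 : v^T != 0 by rewrite -(inj_eq (@trmx_inj _ _ _)) trmxK trmx0.
by rewrite /dot trmxK mulmxA; apply: contraTneq => ->; rewrite mul0mx mxE ltxx.
Qed.

End primal_dual_metric.

(** * Rate of the proximal point method for a monotone operator *)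

Lemma sqr_normM (R : realType) n (M : 'M[R]_n) u :
  0 <= dot u (M *m u) -> normM M u ^+ 2 = dot u (M *m u).
Proof. by rewrite /normM /dot mulmxA; exact: sqr_sqrtr. Qed.

Lemma proximal_point_rate (R : realType) n (P : 'M[R]_n)
    (F : 'cV[R]_n -> set 'cV[R]_n) (zs : 'cV[R]_n) (z : nat -> 'cV[R]_n) :
  P^T = P -> (forall u, 0 <= dot u (P *m u)) ->
  (forall z z' w w', F z w -> F z' w' -> 0 <= dot (w - w') (z - z')) ->
  F zs 0 -> (forall k, F (z k.+1) (P *m (z k - z k.+1))) ->
  forall k, k.+1%:R * dot (z k - z k.+1) (P *m (z k - z k.+1))
    <= dot (z 0 - zs) (P *m (z 0 - zs)).
Proof.
move=> Psym Pge0 Fmono Fzs Fz.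
have symP u v : dot u (P *m v) = dot v (P *m u) by rewrite dotC dot_mull Psym.
pose q u := dot u (P *m u).
have qD u v : q (u + v) = q u + 2 * dot v (P *m u) + q v.
  by rewrite /q mulmxDr !dot_lin (symP u v); lra.
pose d k := z k - z k.+1.
have fejer k : q (z k.+1 - zs) + q (d k) <= q (z k - zs).
  have -> : z k - zs = d k + (z k.+1 - zs) by rewrite addrA subrK.
  have := Fmono _ _ _ _ (Fz k) Fzs; rewrite subr0 dotC (qD (d k)) -/(d k); lra.
(* Monotonicity at [z k.+1] and [z k.+2] makes the cross term of [d k - d k.+1] and [d k.+1]
   nonnegative. *)
have mono k : q (d k.+1) <= q (d k).
  have -> : d k = (d k - d k.+1) + d k.+1 by rewrite subrK.
  have := Fmono _ _ _ _ (Fz k) (Fz k.+1); rewrite -mulmxBr dotC (qD (_ - _)).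
  have := Pge0 (d k - d k.+1); rewrite -/(q _) -/(d k) -/(d k.+1); lra.
(* The induction must carry the remaining distance to [zs], which the next Fejer inequality
   consumes. *)
suff main k : k.+1%:R * q (d k) + q (z k.+1 - zs) <= q (z 0 - zs).
  by move=> k; apply: le_trans (main k); rewrite lerDl; exact: Pge0.
elim: k => [|k IH]; first by have := fejer 0%N; lra.
have := fejer k.+1; have := mono k; rewrite -(natr1 k.+1).
have := ler0n R k.+1; move: (k.+1%:R) IH => K IH K0 m1 f1; nra.
Qed.

(** * PDHG as a proximal point method *)

Section pdhg.
Context {R : realType} {n m : nat}.
Variables (f : 'cV[R]_n -> \bar R) (g : 'cV[R]_m -> \bar R) (A : 'M[R]_(m, n)).
Hypotheses (f_proper : proper_ereal f) (g_proper : proper_ereal g).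

(** The coupling is skew: the terms from [A^T *m y] and [- (A *m x)] cancel, leaving the
    monotonicity of the two subdifferentials. *)
Lemma KKT_monotone z z' w w' : KKT f g A z w -> KKT f g A z' w' ->
  0 <= dot (w - w') (z - z').
Proof.
move=> [u fu [v gv ->]] [u' fu' [v' gv' ->]].
have := subdiff_monotone f_proper fu fu'; have := subdiff_monotone g_proper gv gv'.
have -> : z - z' = col_mx (usubmx z - usubmx z') (dsubmx z - dsubmx z').
  by rewrite -!linearB vsubmxK.
move: (usubmx z) (usubmx z') (dsubmx z) (dsubmx z') => x x' y y' mg mf.
rewrite opp_col_mx add_col_mx dot_col.
have -> : u + A^T *m y - (u' + A^T *m y') = (u - u') + A^T *m (y - y').
  by rewrite mulmxBr opprD addrACA.
have -> : - (A *m x) + v - (- (A *m x') + v') = (v - v') - A *m (x - x').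
  by rewrite mulmxBr !opprD !opprK; apply/matrixP => i j; rewrite !mxE; ring.
rewrite dotDl (dotDl (v - v')) dotNl dot_mull trmxK (dotC (y - y') (_ *m _)).
by rewrite addrACA subrr addr0 addr_ge0.
Qed.

Lemma pdhg_step_KKT (s : R) zstar z : 0 < s ->
  lower_semicontinuous f -> convex_ereal f ->
  lower_semicontinuous g -> convex_ereal g ->
  optimal f g A zstar ->
  KKT f g A (pdhg_step f g A s z) (Pmat A s *m (z - pdhg_step f g A s z)).
Proof.
move=> s0 flsc fconv glsc gconv [us fus [vs gvs _]].
(* The subgradient [us] at the optimal point ensures that a minimizer exists, so [xget] does not
   return its default. *)
have proxf x : subdiff f (prox f s x) (s^-1 *: (x - prox f s x)).
  apply: prox_subdiff => //; apply: xgetPex.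
  exact: prox_set_nonempty fus.
have proxg y : subdiff g (prox g s y) (s^-1 *: (y - prox g s y)).
  apply: prox_subdiff => //; apply: xgetPex.
  exact: prox_set_nonempty gvs.
rewrite -(vsubmxK z); move: (usubmx z) (dsubmx z) => x y.
rewrite /KKT /pdhg_step /= !col_mxKu !col_mxKd.
set x' := prox f s _; set y' := prox g s _.
(* In the second block the extrapolated point gives [A (2 x' - x) - A x' = - A (x - x')], exactly
   the off-diagonal term of [Pmat A s]. *)
exists (s^-1 *: (x - s *: (A^T *m y) - x')); first exact: proxf.
exists (s^-1 *: (y + s *: (A *m (2 *: x' - x)) - y')); first exact: proxg.
have sN0 : s != 0 by rewrite gt_eqF.
rewrite opp_col_mx add_col_mx mul_Pmat_col; congr col_mx.
  rewrite mulmxBr !scalerDr !scalerN scalerA mulVf// scale1r.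
  by apply/matrixP => i j; rewrite !mxE; ring.
rewrite !mulmxBr -scalemxAr !scalerDr !scalerN !scalerA mulVf// scale1r.
by apply/matrixP => i j; rewrite !mxE; ring.
Qed.

End pdhg.

Theorem theorem1 (R : realType) (n m : nat)
    (f : 'cV[R]_n -> \bar R) (g : 'cV[R]_m -> \bar R) (A : 'M[R]_(m, n))
    (f_proper : proper_ereal f) (f_lsc : lower_semicontinuous f)
    (f_convex : convex_ereal f)
    (g_proper : proper_ereal g) (g_lsc : lower_semicontinuous g)
    (g_convex : convex_ereal g)
    (zstar : 'cV[R]_(n + m)) (zstar_opt : optimal f g A zstar)
    (s : R) (s_gt0 : 0 < s) (s_lt : (s%:E < ((opnorm A)%:E)^-1)%E)
    (z0 : 'cV[R]_(n + m)) (k : nat) (k_ge1 : (1 <= k)%N) :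
  ((distM (invmx (Pmat A s)) 0 (KKT f g A (pdhg f g A s z0 k))) ^+ 2
    <= (k%:R^-1 * normM (Pmat A s) (z0 - zstar) ^+ 2)%:E)%E.
Proof.
have stepP j : KKT f g A (pdhg f g A s z0 j.+1)
    (Pmat A s *m (pdhg f g A s z0 j - pdhg f g A s z0 j.+1)).
  exact: pdhg_step_KKT zstar_opt.
have Pge0 := Pmat_ge0 s_gt0 s_lt.
case: k k_ge1 => // k _.
have := proximal_point_rate (tr_Pmat A s) Pge0
  (@KKT_monotone _ _ _ _ _ A f_proper g_proper) zstar_opt stepP k.
set d := pdhg _ _ _ _ _ k - _ => rate.
have dist_le : (distM (invmx (Pmat A s)) 0 (KKT f g A (pdhg f g A s z0 k.+1))
    <= (normM (Pmat A s) d)%:E)%E.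
  apply: ge_ereal_inf; exists (normM (invmx (Pmat A s)) (Pmat A s *m d - 0))%:E.
    by exists (Pmat A s *m d).
  rewrite subr0 /normM trmx_mul tr_Pmat -!mulmxA mulKmx//.
  exact: Pmat_unit.
(* Nonnegativity of the distance is what lets the bound be squared in the extended reals. *)
have dist_ge0 : (0 <= distM (invmx (Pmat A s)) 0
    (KKT f g A (pdhg f g A s z0 k.+1)))%E.
  by apply: le_ereal_inf_tmp => _ [u _ <-]; rewrite lee_fin sqrtr_ge0.
apply: (@le_trans _ _ ((normM (Pmat A s) d) ^+ 2)%:E).
  by rewrite EFin_expe lee_sqr// lee_fin sqrtr_ge0.
by rewrite lee_fin !sqr_normM// mulrC ler_pdivlMr// mulrC.
Qed.
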